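(* Let $A,B\in\mathcal{M}_n^+$ be such that $B\le A$. Then, for $j=1,2,\dots,n$, $$s_j(A\nabla B-A\sharp B)\le\frac{1}{8}\,s_j\!\left((A\sharp B)^{-\frac12}(A-B)^2(A\sharp B)^{-\frac12}\right)\le\frac18\, s_j\!\left(B^{-\frac12}(A-B)^2B^{-\frac12}\right)$$ and $$s_j(A\nabla B-A\sharp B)\ge\frac{1}{8}\,s_j\!\left((A\nabla B)^{-\frac12}(A-B)^2(A\nabla B)^{-\frac12}\right)\ge\frac18\, s_j\!\left(A^{-\frac12}(A-B)^2A^{-\frac12}\right).$$
   Context: $\mathcal{M}_n^+$ denotes the set of positive (definite) $n\times n$ complex matrices: $A\in\mathcal{M}_n^+$ iff $\langle Ax,x\rangle>0$ for all nonzero $x\in\mathbb{C}^n$. For Hermitian matrices, $X\le Y$ means that $Y-X$ is positive semidefinite. For $A,B\in\mathcal{M}_n^+$, the arithmetic mean is $A\nabla B=\frac{A+B}{2}$ and the geometric mean is $A\sharp B=A^{1/2}\left(A^{-1/2}BA^{-1/2}\right)^{1/2}A^{1/2}$. $s_j(X)$ denotes the $j$-th singular value of the $n\times n$ matrix $X$, the singular values being arranged in decreasing order and counted with multiplicity. *)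

(* Defs.v *)
From mathcomp Require Import all_boot all_order all_algebra.

Set Implicit Arguments.
Unset Strict Implicit.
Unset Printing Implicit Defensive.

Import Order.TTheory GRing.Theory Num.Theory.
Local Open Scope ring_scope.
Local Open Scope sesquilinear_scope.

(* The order of a numClosedFieldType C is partial: [0 <= z] (resp. [0 < z])
   says that z is real and nonnegative (resp. positive), as for complex
   numbers.  All definitions below are meant for C = R[i]. *)

(* <M x, x>, linear in the first argument and antilinear in the second one *)
Definition qform (C : numClosedFieldType) n (M : 'M[C]_n) (x : 'cV[C]_n) : C :=
  (x ^t* *m (M *m x)) 0 0.

Definition posdefmx (C : numClosedFieldType) n (M : 'M[C]_n) : Prop :=
  forall x : 'cV[C]_n, x != 0 -> 0 < qform M x.

Definition possemidefmx (C : numClosedFieldType) n (M : 'M[C]_n) : Prop :=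
  forall x : 'cV[C]_n, 0 <= qform M x.

Definition lemx (C : numClosedFieldType) n (X Y : 'M[C]_n) : Prop :=
  possemidefmx (Y - X).

(* M^(1/2), by functional calculus: if M is positive semidefinite and
   M = U^-1 D U with U unitary and D diagonal, this is U^-1 D^(1/2) U, the
   unique positive semidefinite square root of M.  It is only used for
   such M. *)
Definition sqrtmx (C : numClosedFieldType) n (M : 'M[C]_n) : 'M[C]_n :=
  invmx (spectralmx M) *m diag_mx (map_mx sqrtC (spectral_diag M))
    *m spectralmx M.

(* M^(-1/2) *)
Definition rsqrtmx (C : numClosedFieldType) n (M : 'M[C]_n) : 'M[C]_n :=
  invmx (sqrtmx M).

Definition amean (C : numClosedFieldType) n (A B : 'M[C]_n) : 'M[C]_n :=
  2^-1 *: (A + B).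

Definition gmean (C : numClosedFieldType) n (A B : 'M[C]_n) : 'M[C]_n :=
  sqrtmx A *m sqrtmx (rsqrtmx A *m B *m rsqrtmx A) *m sqrtmx A.

(* The square roots of the eigenvalues of X^* X, counted with multiplicity, in
   decreasing order.  These eigenvalues are nonnegative, hence comparable. *)
Definition singular_values (C : numClosedFieldType) n (X : 'M[C]_n) : seq C :=
  sort >=%R [seq sqrtC (spectral_diag (X ^t* *m X) 0 i) | i <- enum 'I_n].

(* Indexed from 0: [singular_value X j] is the (j+1)-st singular value. *)
Definition singular_value (C : numClosedFieldType) n (X : 'M[C]_n) (j : 'I_n)
    : C :=
  nth 0 (singular_values X) j.

(* Main.v *)
Require Import Defs.
From mathcomp Require Import all_boot all_order all_algebra.
From mathcomp Require Import reals.
From mathcomp Require Import complex.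
From mathcomp Require Import ring.

(* With C = A^(-1/2) B A^(-1/2) = U^-1 diag(s^2) U and X = A^(1/2) U^-1, the
   matrices A, B and A # B are X diag(f) X^* for f = 1, s^2 and s, where
   0 < s <= 1 because B <= A.  Since Y Y^* and Y^* Y have the same eigenvalues,
   M^(-1/2) (A - B)^2 M^(-1/2) has the singular values of (A - B) M^-1 (A - B),
   which is again of the form X diag(f) X^* when M is.  All five matrices are
   then compared in the Loewner order by inequalities between scalar functions
   of s, and Weyl's monotonicity principle concludes. *)

Set Implicit Arguments.
Unset Strict Implicit.
Unset Printing Implicit Defensive.

Import Order.TTheory GRing.Theory Num.Theory.
Local Open Scope ring_scope.
Local Open Scope sesquilinear_scope.

(** The block matrix [Z] is reduced by triangular factors in two ways: on the right this gives
    [\det Z = char_poly (A *m B)], on the left ['X^n * \det Z = 'X^n * char_poly (B *m A)], and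
    ['X^n] cancels. *)
Lemma char_poly_mulC (F : fieldType) n (A B : 'M[F]_n) :
  char_poly (A *m B) = char_poly (B *m A).
Proof.
pose A' := map_mx polyC A; pose B' := map_mx polyC B.
pose Z : 'M[{poly F}]_(n + n) := block_mx 'X%:M A' B' 1%:M.
have detZ : \det Z = char_poly (A *m B).
  have : Z *m block_mx 1%:M 0 (- B') 1%:M
         = block_mx ('X%:M - A' *m B') A' 0 1%:M.
    by rewrite mulmx_block !(mulmx1, mulmx0, mul1mx, mulmxN, addr0, add0r, subrr).
  move/(congr1 determinant); rewrite det_mulmx det_lblock det_ublock !det1 !mulr1.
  by rewrite /char_poly /char_poly_mx map_mxM => ->.
have : block_mx 1%:M 0 (- B') 'X%:M *m Z
       = block_mx 'X%:M A' 0 ('X%:M - B' *m A').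
  rewrite mulmx_block !(mulmx1, mulmx0, mul1mx, mul0mx, mulNmx, addr0, add0r).
  by rewrite mul_mx_scalar mul_scalar_mx addNr addrC.
move/(congr1 determinant); rewrite det_mulmx det_lblock det_ublock det1 mul1r.
rewrite det_scalar detZ => /mulfI; rewrite expf_neq0 ?polyX_eq0 //.
by move=> ->; rewrite // /char_poly /char_poly_mx map_mxM.
Qed.

Section Matrices.
Variable C : numClosedFieldType.

(** * Adjoints and real quadratic forms *)

Lemma adjmxM m n p (A : 'M[C]_(m, n)) (B : 'M[C]_(n, p)) :
  (A *m B)^t* = B^t* *m A^t*.
Proof. by rewrite trmx_mul map_mxM. Qed.

(** Positivity is stated through the quadratic form alone; self-adjointness is recovered from it
    here. The form [s] of [M - M^t*] vanishes on the diagonal, hence everywhere by polarization. *)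
Lemma qform_real_hermitian n (M : 'M[C]_n) :
  (forall x, qform M x \is Num.real) -> M^t* = M.
Proof.
move=> Mreal; pose S := M - M^t*.
pose s (x y : 'cV[C]_n) : C := (x^t* *m (S *m y)) 0 0.
have s0 x : s x x = 0.
  have -> : s x x = qform M x - (qform M x)^*.
    have adjE : (x^t* *m (M^t* *m x)) 0 0 = (qform M x)^*.
      have -> : x^t* *m (M^t* *m x) = (x^t* *m (M *m x))^t*.
        by rewrite !adjmxM trmxCK mulmxA.
      by rewrite mxE mxE.
    by rewrite -adjE /qform /s /S mulmxBl mulmxBr !mxE.
  by rewrite conj_Creal ?subrr.
have sD x y z t : s (x + y) (z + t) = s x z + s x t + s y z + s y t.
  rewrite /s linearD /= map_mxD !(mulmxDl, mulmxDr) !mxE; ring.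
have sZr a x y : s x (a *: y) = a * s x y by rewrite /s -!scalemxAr mxE.
have sZl a x y : s (a *: x) y = a^* * s x y.
  by rewrite /s linearZ /= map_mxZ -scalemxAl mxE.
have sym x y : s x y = 0.
  have e1 := s0 (x + y); rewrite sD !s0 add0r addr0 in e1.
  (* [x + y] makes [s] antisymmetric; [x + 'i *: y] makes it symmetric, because conjugation sends
     ['i] to [- 'i]. Hence twice [s x y] is zero. *)
  have := s0 (x + 'i *: y).
  rewrite sD sZr sZl s0 sZr sZl s0 conjCi !mulr0 add0r addr0 mulNr -mulrBr.
  move/eqP; rewrite mulf_eq0 (negPf (neq0Ci C)) /= subr_eq0 => /eqP e2.
  move: e1; rewrite -e2 -mulr2n => /eqP.
  by rewrite mulrn_eq0 /= => /eqP.
apply/esym/eqP; rewrite -subr_eq0 -/S; apply/eqP/matrixP => i j.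
have := sym (delta_mx i 0) (delta_mx j 0).
rewrite /s -colE trmx_delta map_delta_mx -rowE !mxE.
by move=> ->.
Qed.

(** * Calculus of the matrices X diag(f) X^* *)

Definition congmx m n (X : 'M[C]_(m, n)) (f : 'I_n -> C) : 'M[C]_m :=
  X *m diag_mx (\row_i f i) *m X^t*.

Lemma congmxB m n (X : 'M[C]_(m, n)) f g :
  congmx X f - congmx X g = congmx X (fun i => f i - g i).
Proof.
rewrite /congmx -mulmxBl -mulmxBr -linearB /=.
by congr (_ *m diag_mx _ *m _); apply/rowP => i; rewrite !mxE.
Qed.

Lemma congmxD m n (X : 'M[C]_(m, n)) f g :
  congmx X f + congmx X g = congmx X (fun i => f i + g i).
Proof.
rewrite /congmx -mulmxDl -mulmxDr -linearD /=.
by congr (_ *m diag_mx _ *m _); apply/rowP => i; rewrite !mxE.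
Qed.

Lemma congmxZ m n (X : 'M[C]_(m, n)) a f :
  a *: congmx X f = congmx X (fun i => a * f i).
Proof.
rewrite /congmx scalemxAl scalemxAr -linearZ /=.
by congr (_ *m diag_mx _ *m _); apply/rowP => i; rewrite !mxE.
Qed.

Lemma eq_congmx m n (X : 'M[C]_(m, n)) f g : f =1 g -> congmx X f = congmx X g.
Proof.
by move=> fg; congr (_ *m diag_mx _ *m _); apply/rowP => i; rewrite !mxE.
Qed.

Lemma congmx1 m n (X : 'M[C]_(m, n)) : congmx X (fun=> 1) = X *m X^t*.
Proof.
rewrite /congmx; have -> : (\row_i 1 : 'rV[C]_n) = const_mx 1.
  by apply/rowP => i; rewrite !mxE.
by rewrite diag_const_mx mulmx1.
Qed.

Lemma mul_congmx m n p (Y : 'M[C]_(p, m)) (X : 'M[C]_(m, n)) f :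
  Y *m congmx X f *m Y^t* = congmx (Y *m X) f.
Proof. by rewrite /congmx adjmxM !mulmxA. Qed.

(** The left matrix [Z] is left free so that the result can serve again as the left factor of a
    further product. *)
Lemma congmxM m n p (X : 'M[C]_(m, n)) (Y : 'M[C]_(m, n)) (Z : 'M[C]_(p, n)) f g :
  X^t* *m Y = 1%:M ->
  (Z *m diag_mx (\row_i f i) *m X^t*) *m congmx Y g
  = Z *m diag_mx (\row_i (f i * g i)) *m Y^t*.
Proof.
move=> XY; rewrite /congmx !mulmxA -[_ *m X^t* *m Y]mulmxA XY mulmx1.
rewrite -[Z *m _ *m _]mulmxA; congr (_ *m _ *m _); rewrite mulmx_diag.
by congr diag_mx; apply/rowP => i; rewrite !mxE.
Qed.

Lemma congmx_adj m n (X : 'M[C]_(m, n)) f :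
  (forall i, f i \is Num.real) -> (congmx X f)^t* = congmx X f.
Proof.
move=> fr; rewrite /congmx !adjmxM trmxCK mulmxA; congr (_ *m _ *m _).
rewrite tr_diag_mx map_diag_mx; congr diag_mx; apply/rowP => i.
by rewrite !mxE; apply: conj_Creal.
Qed.

Lemma qform_congmx m n (X : 'M[C]_(m, n)) f x :
  qform (congmx X f) x = \sum_i f i * `|(X^t* *m x) i 0| ^+ 2.
Proof.
rewrite /qform /congmx.
have -> : x^t* *m (X *m diag_mx (\row_i f i) *m X^t* *m x)
   = (X^t* *m x)^t* *m (diag_mx (\row_i f i) *m (X^t* *m x)).
  by rewrite adjmxM trmxCK !mulmxA.
rewrite mxE; apply: eq_bigr => i _; rewrite mul_diag_mx !mxE.
rewrite normCK; ring.
Qed.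

Lemma congmx_posdef m n (X : 'M[C]_(m, n)) f : row_free X ->
  (forall i, 0 < f i) -> posdefmx (congmx X f).
Proof.
move=> Xfree f0 x x0; rewrite qform_congmx lt_def sumr_ge0 ?andbT; last first.
  by move=> i _; rewrite mulr_ge0 ?exprn_ge0 // ltW.
apply: contraNneq x0 => /eqP; rewrite psumr_eq0 => [/allP y0|i _]; last first.
  by rewrite mulr_ge0 ?exprn_ge0 // ltW.
(* All coordinates of [X^t* *m x] vanish because the weights are positive; row freeness of [X] then
   kills [x]. *)
suff : x^t* = 0.
  by move/(congr1 (fun z => z^t*)); rewrite trmxCK => ->; rewrite trmx0 map_mx0.
apply: (row_free_inj Xfree); rewrite mul0mx -[_ *m _]trmxCK adjmxM trmxCK.
suff -> : X^t* *m x = 0 by rewrite trmx0 map_mx0.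
apply/matrixP => i k; rewrite ord1 [RHS]mxE.
have /implyP/(_ isT) := y0 i (mem_index_enum _).
by rewrite mulf_eq0 gt_eqF //= expf_eq0 normr_eq0 => /eqP.
Qed.

Lemma congmx_possemidef m n (X : 'M[C]_(m, n)) f :
  (forall i, 0 <= f i) -> possemidefmx (congmx X f).
Proof.
move=> f0 x; rewrite qform_congmx sumr_ge0 // => i _.
by rewrite mulr_ge0 ?exprn_ge0.
Qed.

(** * Positive matrices, spectral decomposition and square roots *)

Lemma posdefmxW n (M : 'M[C]_n) : posdefmx M -> possemidefmx M.
Proof.
move=> Mp x; case: (eqVneq x 0) => [->|/Mp/ltW //].
by rewrite /qform !mulmx0 mxE.
Qed.

Lemma possemidefmx_adj n (M : 'M[C]_n) : possemidefmx M -> M^t* = M.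
Proof. by move=> Mp; apply: qform_real_hermitian => x; apply: ger0_real. Qed.

Lemma posdefmx_unit n (M : 'M[C]_n) : posdefmx M -> M \in unitmx.
Proof.
move=> Mp; rewrite -unitmx_tr -row_free_unit -kermx_eq0.
apply/rowV0P => v /sub_kermxP vM; apply/eqP; apply: contraT => v0.
have := Mp v^T; rewrite trmx_eq0 => /(_ v0).
rewrite /qform -[M]trmxK -trmx_mul vM.
by rewrite trmx0 mulmx0 mxE ltxx.
Qed.

Lemma mul_spectralmx_adj n (M : 'M[C]_n) :
  spectralmx M *m (spectralmx M)^t* = 1%:M.
Proof. exact/unitarymxP/spectral_unitarymx. Qed.

Lemma spectralE n (M : 'M[C]_n) : M^t* = M ->
  M = congmx ((spectralmx M)^t*) (spectral_diag M 0).
Proof.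
move=> Mh; have /orthomx_spectralP : M \is normalmx by apply/normalmxP; rewrite Mh.
rewrite invmx_unitary ?spectral_unitarymx // => {1}->.
rewrite /congmx trmxCK; congr (_ *m diag_mx _ *m _).
by apply/rowP => i; rewrite mxE.
Qed.

(** The argument of the form is the unit eigenvector number [i], so each eigenvalue is a value of
    the form and inherits its sign. *)
Lemma qform_spectral n (M : 'M[C]_n) i : M^t* = M ->
  qform M ((spectralmx M)^t* *m delta_mx i 0) = spectral_diag M 0 i.
Proof.
move=> Mh; rewrite {1}(spectralE Mh) qform_congmx trmxCK mulmxA.
rewrite mul_spectralmx_adj mul1mx (bigD1 i) //= big1 => [|k ki]; last first.
  by rewrite !mxE (negPf ki) normr0 expr0n mulr0.
by rewrite !mxE !eqxx normr1 expr1n mulr1 addr0.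
Qed.

Lemma spectral_diag_ge0 n (M : 'M[C]_n) i :
  possemidefmx M -> 0 <= spectral_diag M 0 i.
Proof. by move=> Mp; rewrite -qform_spectral //; apply: possemidefmx_adj. Qed.

Lemma spectral_diag_gt0 n (M : 'M[C]_n) i :
  posdefmx M -> 0 < spectral_diag M 0 i.
Proof.
move=> Mp; rewrite -qform_spectral; last exact/possemidefmx_adj/posdefmxW.
apply: Mp; apply/eqP => /(congr1 (mulmx (spectralmx M))).
rewrite mulmxA mul_spectralmx_adj mul1mx mulmx0 => /matrixP/(_ i 0).
by rewrite !mxE !eqxx; apply/eqP/oner_neq0.
Qed.

Lemma sqrtmxE n (M : 'M[C]_n) :
  sqrtmx M = congmx ((spectralmx M)^t*) (fun i => sqrtC (spectral_diag M 0 i)).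
Proof.
rewrite /sqrtmx invmx_unitary ?spectral_unitarymx // /congmx trmxCK.
by congr (_ *m diag_mx _ *m _); apply/rowP => i; rewrite !mxE.
Qed.

Lemma sqrtmx_adj n (M : 'M[C]_n) : possemidefmx M -> (sqrtmx M)^t* = sqrtmx M.
Proof.
move=> Mp; rewrite sqrtmxE congmx_adj // => i.
by rewrite ger0_real // sqrtC_ge0 spectral_diag_ge0.
Qed.

Lemma sqrtmxK n (M : 'M[C]_n) : possemidefmx M -> sqrtmx M *m sqrtmx M = M.
Proof.
move=> Mp; rewrite [RHS]spectralE; last exact: possemidefmx_adj.
rewrite !sqrtmxE [X in X *m _]/congmx congmxM.
  apply: eq_congmx => i; by rewrite -expr2 sqrtCK.
by rewrite trmxCK mul_spectralmx_adj.
Qed.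

Lemma sqrtmx_unit n (M : 'M[C]_n) : posdefmx M -> sqrtmx M \in unitmx.
Proof.
move=> Mp; have := posdefmx_unit Mp.
by rewrite -{1}(sqrtmxK (posdefmxW Mp)) unitmx_mul andbb.
Qed.

Lemma rsqrtmx_adj n (M : 'M[C]_n) : posdefmx M -> (rsqrtmx M)^t* = rsqrtmx M.
Proof.
by move=> Mp; rewrite /rsqrtmx trmx_inv map_invmx sqrtmx_adj //; apply: posdefmxW.
Qed.

Lemma invmx_uniq n (M N : 'M[C]_n) : M *m N = 1%:M -> invmx M = N.
Proof.
move=> MN; have [Mu _] := mulmx1_unit MN.
by rewrite -[RHS](mulKmx Mu) MN mulmx1.
Qed.

Lemma mul_rsqrtmx n (M : 'M[C]_n) : posdefmx M ->
  rsqrtmx M *m rsqrtmx M = invmx M.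
Proof.
move=> Mp; apply/esym/invmx_uniq; have Su := sqrtmx_unit Mp.
rewrite -{1}(sqrtmxK (posdefmxW Mp)) /rsqrtmx mulmxA.
by rewrite -[_ *m sqrtmx M *m _]mulmxA mulmxV // mulmx1 mulmxV.
Qed.


(** * Spectra and singular values through characteristic polynomials *)

Lemma char_poly_congmx n (U : 'M[C]_n) f : U^t* *m U = 1%:M ->
  char_poly (congmx U f) = \prod_(x <- [seq f i | i <- enum 'I_n]) ('X - x%:P).
Proof.
move=> UU; rewrite char_poly_mulC mulmxA UU mul1mx.
rewrite char_poly_trig ?diag_mx_is_trig // big_map big_enum /=.
by apply: eq_bigr => i _; rewrite !mxE eqxx.
Qed.

Definition spectrum n (M : 'M[C]_n) : seq C :=
  [seq spectral_diag M 0 i | i <- enum 'I_n].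

Lemma char_poly_spectrum n (M : 'M[C]_n) : M^t* = M ->
  char_poly M = \prod_(x <- spectrum M) ('X - x%:P).
Proof.
move=> Mh; rewrite {1}(spectralE Mh) char_poly_congmx //.
by rewrite trmxCK mul_spectralmx_adj.
Qed.

(** The order of the entries of [spectral_diag] is not controlled; as roots of the characteristic
    polynomial they are fixed up to permutation. *)
Lemma perm_spectrum_congmx n (U : 'M[C]_n) f : U^t* *m U = 1%:M ->
  (forall i, f i \is Num.real) ->
  perm_eq (spectrum (congmx U f)) [seq f i | i <- enum 'I_n].
Proof.
move=> UU fr; apply: prod_XsubC_eq.
by rewrite -(char_poly_congmx f UU) char_poly_spectrum // congmx_adj.
Qed.

Lemma ge_rel_trans : transitive (>=%R : rel C).
Proof. by move=> y x z /= yx zy; apply: le_trans zy yx. Qed.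

(** The order of [C] is partial, so sorting is canonical only on comparable entries; nonnegative
    ones are real, hence comparable. *)
Lemma sort_ge0_perm (s1 s2 : seq C) : all (fun x => 0 <= x) s1 ->
  perm_eq s1 s2 -> sort >=%R s1 = sort >=%R s2.
Proof.
move=> /allP s0 s12; apply/perm_sort_inP => //.
- by move=> x y /s0 x0 /s0 y0; rewrite orbC real_leVge ?ger0_real.
- by move=> y x z _ _ _; apply: ge_rel_trans.
- by move=> x y _ _ /= /andP[yx xy]; apply/le_anti/andP.
Qed.

Lemma singular_values_congmx n (U : 'M[C]_n) (f : 'I_n -> C) : U^t* *m U = 1%:M ->
  (forall i, 0 <= f i) ->
  singular_values (congmx U f) = sort >=%R [seq f i | i <- enum 'I_n].
Proof.
move=> UU f0; rewrite /singular_values congmx_adj; last first.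
  by move=> i; apply: ger0_real.
rewrite [X in X *m _]/congmx congmxM // -/(congmx U (fun i => f i * f i)).
(* Both sides become images under [sqrtC], so it suffices to compare the spectrum of X^* X with the
   squares of the weights. *)
have -> : [seq f i | i <- enum 'I_n]
    = map sqrtC [seq f i * f i | i <- enum 'I_n].
  by rewrite -[RHS]map_comp; apply: eq_map => i /=; rewrite -expr2 sqrCK.
set g := fun i => f i * f i.
have g0 i : 0 <= g i by rewrite mulr_ge0.
apply: sort_ge0_perm.
  apply/allP => _ /mapP[i _ ->]; rewrite sqrtC_ge0.
  by apply/spectral_diag_ge0/congmx_possemidef.
rewrite -/(spectrum _) (map_comp sqrtC) perm_map //.
by apply: perm_spectrum_congmx => // i; apply: ger0_real.
Qed.

Lemma singular_values_psd n (M : 'M[C]_n) : possemidefmx M ->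
  singular_values M = sort >=%R (spectrum M).
Proof.
move=> Mp; rewrite {1}(spectralE (possemidefmx_adj Mp)) singular_values_congmx //.
  by rewrite trmxCK mul_spectralmx_adj.
by move=> i; apply: spectral_diag_ge0.
Qed.

Lemma all_spectrum_ge0 n (M : 'M[C]_n) : possemidefmx M ->
  all (fun x => 0 <= x) (spectrum M).
Proof. by move=> Mp; apply/allP => _ /mapP[i _ ->]; apply: spectral_diag_ge0. Qed.

(** For semidefinite matrices the singular values are the eigenvalues. This allows a product to be
    replaced by a cyclic rearrangement of its factors. *)
Lemma eq_singular_values n (M N : 'M[C]_n) : possemidefmx M -> possemidefmx N ->
  char_poly M = char_poly N -> singular_values M = singular_values N.
Proof.
move=> Mp Np MN; rewrite !singular_values_psd //.
apply: sort_ge0_perm; first exact: all_spectrum_ge0.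
by apply: prod_XsubC_eq; rewrite -!char_poly_spectrum // possemidefmx_adj.
Qed.

Lemma sorted_sort_ge0 (s : seq C) : all (fun x => 0 <= x) s ->
  sorted >=%R (sort >=%R s).
Proof.
apply: (@sort_sorted_in _ (fun x => 0 <= x)) => x y x0 y0.
by rewrite orbC real_leVge ?ger0_real.
Qed.

Lemma singular_valueZ n (a : C) (M : 'M[C]_n) j : 0 < a -> possemidefmx M ->
  singular_value (a *: M) j = a * singular_value M j.
Proof.
move=> a0 Mp; have Mh := possemidefmx_adj Mp.
have UU : ((spectralmx M)^t*)^t* *m (spectralmx M)^t* = 1%:M.
  by rewrite trmxCK mul_spectralmx_adj.
have d0 i := spectral_diag_ge0 i Mp.
rewrite /singular_value (singular_values_psd Mp).
rewrite {1}(spectralE Mh) congmxZ singular_values_congmx //; last first.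
  by move=> i; rewrite mulr_ge0 // ltW.
have -> : a * nth 0 (sort >=%R (spectrum M)) j
          = nth 0 [seq a * x | x <- sort >=%R (spectrum M)] j.
  by rewrite (nth_map 0) // size_sort size_map size_enum_ord.
rewrite (map_comp ( *%R a)) -/(spectrum M); congr (nth _ _ _).
have aM0 s : all (fun x => 0 <= x) s -> all (fun x => 0 <= x) [seq a * x | x <- s].
  move=> /allP s0; apply/allP => _ /mapP[x /s0 x0 ->].
  by rewrite mulr_ge0 // ltW.
have M0 := all_spectrum_ge0 Mp.
(* The scaled list is already decreasing, so sorting leaves it fixed; both sides are then sorts of
   permuted lists. *)
have <- : sort >=%R [seq a * x | x <- sort >=%R (spectrum M)]
          = [seq a * x | x <- sort >=%R (spectrum M)].
  apply: sorted_sort ; first exact: ge_rel_trans.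
  rewrite sorted_map; apply: sub_sorted (sorted_sort_ge0 M0) => x y /=.
  by rewrite ler_pM2l.
apply: sort_ge0_perm; first exact: aM0.
by rewrite perm_map // perm_sym perm_sort.
Qed.

(** * Weyl's monotonicity principle by counting eigenvalues *)

Lemma count_nth_sorted (s : seq C) j : (j < size s)%N -> sorted >=%R s ->
  (j < count (fun x => (nth 0 s j <= x)%R) s)%N.
Proof.
move=> js ss; set p := fun x => _.
rewrite -(cat_take_drop j.+1 s) count_cat.
suff: all p (take j.+1 s).
  by rewrite all_count => /eqP ->; rewrite size_takel // leq_addr.
apply/(all_nthP 0) => k; rewrite size_takel // => kj; rewrite nth_take //.
apply: (sorted_leq_nth ge_rel_trans lexx 0 ss) => //.
exact: leq_ltn_trans js.
Qed.

(** By contraposition: if entry [j] is below [t], so are all later ones, and at most the [j] entries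
    before it reach [t]. Indices start at 0, hence the strict [j < count]. *)
Lemma nth_count_sorted (s : seq C) j t : t \is Num.real ->
  all (fun x => 0 <= x) s -> sorted >=%R s ->
  (j < count (fun x => (t <= x)%R) s)%N -> t <= nth 0 s j.
Proof.
move=> tr s0 ss jc.
have js : (j < size s)%N by apply: leq_trans jc (count_size _ _).
have nr : nth 0 s j \is Num.real by rewrite ger0_real // (allP s0) ?mem_nth.
rewrite real_leNgt //; apply: contraL jc => lt.
rewrite -leqNgt -(cat_take_drop j s) count_cat.
suff /eqP -> : count (fun x => (t <= x)%R) (drop j s) == 0%N.
  by rewrite addn0 (leq_trans (count_size _ _)) // size_take js.
rewrite -leqn0 leqNgt -has_count; apply/hasPn => _ /(nthP 0)[k kd <-].
rewrite size_drop in kd; rewrite nth_drop; apply/negP => le.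
have : nth 0 s (j + k) <= nth 0 s j.
  apply: (sorted_leq_nth ge_rel_trans lexx 0 ss) => //; last exact: leq_addr.
  by rewrite inE -ltn_subRL.
by move=> /(le_trans le); rewrite real_leNgt // lt.
Qed.


(** Dimension count: the selected columns impose fewer than [m] linear equations on [m] unknowns, so
    the left kernel is nonzero. *)
Lemma exists_colsub_eq0 m n1 n2 (M1 : 'M[C]_(m, n1)) (M2 : 'M[C]_(m, n2))
    (I : pred 'I_n1) (J : pred 'I_n2) : (#|I| + #|J| < m)%N ->
  exists2 v : 'rV[C]_m, v != 0
    & (forall i, I i -> (v *m M1) 0 i = 0) /\ (forall j, J j -> (v *m M2) 0 j = 0).
Proof.
move=> IJm.
have colsub0 n (M : 'M[C]_(m, n)) (K : pred 'I_n) (v : 'rV_m) :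
    v *m colsub (@enum_val _ K) M = 0 -> forall i, K i -> (v *m M) 0 i = 0.
  move=> vM i Ki; move/rowP/(_ (enum_rank_in Ki i)): vM.
  by rewrite mulmx_colsub !mxE enum_rankK_in.
pose M := row_mx (colsub (@enum_val _ I) M1) (colsub (@enum_val _ J) M2).
have : kermx M != 0.
  by rewrite kermx_eq0 /row_free neq_ltn (leq_ltn_trans (rank_leq_col M)).
case/rowV0Pn => v /sub_kermxP; rewrite mul_mx_row -row_mx0 => /eq_row_mx[v1 v2] v0.
by exists v => //; split; apply: colsub0.
Qed.

(* Otherwise the span of the eigenvectors of P with eigenvalue at least t meets
   that of the eigenvectors of Q with eigenvalue less than t. *)
Lemma count_spectrum_le n (P Q : 'M[C]_n) t : t \is Num.real ->
  possemidefmx P -> possemidefmx Q -> lemx P Q ->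
  (count (fun x => (t <= x)%R) (spectrum P)
     <= count (fun x => (t <= x)%R) (spectrum Q))%N.
Proof.
move=> tr Pp Qp PQ.
have countE M : count (fun x => (t <= x)%R) (spectrum M)
    = #|[pred i : 'I_n | t <= spectral_diag M 0 i]|.
  by rewrite count_map -sum1_count -sum1_card big_enum_cond.
rewrite !countE leqNgt; apply/negP => QP.
pose U := spectralmx P; pose V := spectralmx Q.
(* The vector has no component on eigenvectors of [P] below [t] nor on those of [Q] at or above [t].
   By [QP] these conditions number fewer than [n]. *)
have [|v v0 [vU vV]] := @exists_colsub_eq0 n n n U^T V^T
   [pred i | ~~ (t <= spectral_diag P 0 i)] [pred i | t <= spectral_diag Q 0 i].
  rewrite -[X in (_ < X)%N](card_ord n).
  rewrite -(cardC [pred i | t <= spectral_diag P 0 i]) addnC.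
  by rewrite ltn_add2r.
pose x := v^T.
have xU i : ~~ (t <= spectral_diag P 0 i) -> (U *m x) i 0 = 0.
  by move=> /vU vi; rewrite /x -[U]trmxK -trmx_mul mxE vi.
have xV i : t <= spectral_diag Q 0 i -> (V *m x) i 0 = 0.
  by move=> /vV vi; rewrite /x -[V]trmxK -trmx_mul mxE vi.
have unitE (W : 'M[C]_n) : W^t* *m W = 1%:M :> 'M[C]_n ->
    qform 1%:M x = \sum_i `|(W *m x) i 0| ^+ 2.
  move=> WW; rewrite -WW -[X in _ *m X]trmxCK -congmx1 qform_congmx trmxCK.
  by apply: eq_bigr => i _; rewrite mul1r.
have adjMU M : (spectralmx M)^t* *m spectralmx M = 1%:M :> 'M[C]_n.
  exact/mulmx1C/mul_spectralmx_adj.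
have leP : t * qform 1%:M x <= qform P x.
  rewrite {1}(spectralE (possemidefmx_adj Pp)) qform_congmx trmxCK.
  rewrite (unitE _ (adjMU P)) mulr_sumr ler_sum // => i _.
  have [le|/xU ->] := boolP (t <= spectral_diag P 0 i).
    by rewrite ler_wpM2r ?exprn_ge0.
  by rewrite normr0 expr0n !mulr0.
have ltQ : qform Q x < t * qform 1%:M x.
  rewrite {1}(spectralE (possemidefmx_adj Qp)) qform_congmx trmxCK.
  rewrite (unitE _ (adjMU Q)) mulr_sumr.
  (* Strictness comes from one nonzero coordinate of [V *m x], which exists since [V] is unitary and
     [x] is nonzero. *)
  have /existsP[k xk] : [exists k, (V *m x) k 0 != 0].
    apply: contraNT v0; rewrite negb_exists => /forallP Vx0.
    have Vx : V *m x = 0.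
      by apply/matrixP => i j; rewrite ord1 [RHS]mxE; apply/eqP/negbNE.
    rewrite -trmx_eq0 -/x -[x]mul1mx -(adjMU Q) -mulmxA -/V Vx mulmx0 //.
  have ltd i : (V *m x) i 0 != 0 -> spectral_diag Q 0 i < t.
    move=> xi; rewrite real_ltNge //; first by apply: contraNN xi => /xV ->.
    exact/ger0_real/spectral_diag_ge0.
  rewrite (bigD1 k) //= [ltRHS](bigD1 k) //= ltr_leD //.
    by rewrite ltr_pM2r ?ltd // exprn_gt0 // normr_gt0.
  apply: ler_sum => i _; have [->|xi] := eqVneq ((V *m x) i 0) 0.
    by rewrite normr0 expr0n !mulr0.
  by rewrite ler_wpM2r ?exprn_ge0 // ltW // ltd.
have := PQ x; rewrite /qform mulmxBl mulmxBr mxE [X in _ + X]mxE subr_ge0.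
rewrite -!/(qform _ _) => QPx.
by have := le_lt_trans leP (le_lt_trans QPx ltQ); rewrite ltxx.
Qed.

(** Take as threshold entry [j] for [P]: more than [j] eigenvalues of [P] reach it, hence more than
    [j] of [Q]. *)
Lemma singular_value_le n (P Q : 'M[C]_n) j :
  possemidefmx P -> possemidefmx Q -> lemx P Q ->
  singular_value P j <= singular_value Q j.
Proof.
move=> Pp Qp PQ; rewrite /singular_value !singular_values_psd //.
have [P0 Q0] := (all_spectrum_ge0 Pp, all_spectrum_ge0 Qp).
have szP : (j < size (sort >=%R (spectrum P)))%N.
  by rewrite size_sort size_map size_enum_ord.
have tr : nth 0 (sort >=%R (spectrum P)) j \is Num.real.
  by rewrite ger0_real // (allP P0) // -(mem_sort >=%R) mem_nth.
apply: nth_count_sorted => //.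
- by rewrite all_sort.
- exact: sorted_sort_ge0.
rewrite count_sort (leq_trans _ (count_spectrum_le tr Pp Qp PQ)) //.
rewrite -(count_sort >=%R) count_nth_sorted //.
exact: sorted_sort_ge0.
Qed.


(** * Simultaneous reduction of the pair and its means *)

Lemma posdefmx_congr n (Y M : 'M[C]_n) : Y \in unitmx -> posdefmx M ->
  posdefmx (Y *m M *m Y^t* ).
Proof.
move=> Yu Mp x x0.
have -> : qform (Y *m M *m Y^t* ) x = qform M (Y^t* *m x).
  by rewrite /qform adjmxM trmxCK !mulmxA.
apply: Mp; apply: contraNneq x0 => Yx.
have Yau : Y^t* \in unitmx by rewrite map_unitmx unitmx_tr.
by rewrite -(mulKmx Yau x) Yx mulmx0.
Qed.

(** [X] is invertible but in general not unitary, so the weights are not singular values themselves;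
    they serve only for comparisons in the Loewner order. *)
Lemma posdef_pair_diag n (A B : 'M[C]_n) : posdefmx A -> posdefmx B ->
  exists X (s : 'I_n -> C), [/\ X \in unitmx, forall i, 0 < s i,
    A = congmx X (fun=> 1), B = congmx X (fun i => s i ^+ 2)
    & gmean A B = congmx X s].
Proof.
move=> Ap Bp; have Su := sqrtmx_unit Ap; have Sh := sqrtmx_adj (posdefmxW Ap).
have Rp : posdefmx (rsqrtmx A *m B *m rsqrtmx A).
  by rewrite -{2}rsqrtmx_adj //; apply: posdefmx_congr; rewrite ?unitmx_inv.
set N := _ *m _ *m _ in Rp; pose V := spectralmx N.
exists (sqrtmx A *m V^t* ), (fun i => sqrtC (spectral_diag N 0 i)); split.
- rewrite unitmx_mul Su map_unitmx unitmx_tr; exact: spectral_unit.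
- by move=> i; rewrite sqrtC_gt0 spectral_diag_gt0.
- rewrite congmx1 adjmxM trmxCK mulmxA -[_ *m _ *m V]mulmxA.
  by rewrite (mulmx1C (mul_spectralmx_adj N)) mulmx1 Sh sqrtmxK //; apply: posdefmxW.
- under eq_congmx do rewrite sqrtCK.
  rewrite -mul_congmx -spectralE; last exact/possemidefmx_adj/posdefmxW.
  rewrite Sh /N /rsqrtmx; move: (sqrtmx A) Su => S Su.
  by rewrite !mulmxA mulmxV // mul1mx mulmxKV.
- by rewrite -mul_congmx Sh -sqrtmxE.
Qed.

Lemma singular_values_rsqrt_congmx n (X : 'M[C]_n) m k : X \in unitmx ->
  (forall i, 0 < m i) -> (forall i, k i \is Num.real) ->
  singular_values (rsqrtmx (congmx X m) *m (congmx X k) ^+ 2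
                     *m rsqrtmx (congmx X m))
  = singular_values (congmx X (fun i => k i ^+ 2 / m i)).
Proof.
move=> Xu m0 kr; set M := congmx X m; set K := congmx X k.
have Mp : posdefmx M by apply: congmx_posdef => //; rewrite row_free_unit.
have Rh := rsqrtmx_adj Mp; have Kh : K^t* = K by apply: congmx_adj.
have -> : rsqrtmx M *m K ^+ 2 *m rsqrtmx M = (rsqrtmx M *m K) *m (K *m rsqrtmx M).
  by rewrite expr2 -!mulmxA.
apply: eq_singular_values.
- have -> : K *m rsqrtmx M = (rsqrtmx M *m K)^t* by rewrite adjmxM Rh Kh.
  by rewrite -congmx1; apply: congmx_possemidef => _; apply: ler01.
- apply: congmx_possemidef => i.
  by rewrite divr_ge0 ?(ltW (m0 i)) // -realEsqr.
(* Swapping the two factors brings the inverse square roots together and leaves K M^-1 K. *)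
rewrite char_poly_mulC mulmxA -[K *m _ *m _]mulmxA mul_rsqrtmx //.
(* The columns of [Y] form the basis dual to those of [X]: inner factors cancel, and M^-1 is the
   congruence by [Y] with inverse weights. *)
pose Y := (invmx X)^t*.
have XY : X^t* *m Y = 1%:M by rewrite -adjmxM mulVmx // trmx1 map_mx1.
have YX : Y^t* *m X = 1%:M by rewrite trmxCK mulVmx.
have -> : invmx M = congmx Y (fun i => (m i)^-1).
  apply: invmx_uniq; rewrite /M {1}/congmx congmxM //.
  have -> : (\row_i (m i * (m i)^-1) : 'rV_n) = const_mx 1.
    by apply/rowP => i; rewrite !mxE mulfV // gt_eqF.
  by rewrite diag_const_mx mulmx1 trmxCK mulmxV.
have -> : K *m congmx Y (fun i => (m i)^-1)
          = X *m diag_mx (\row_i (k i / m i)) *m Y^t* by apply: congmxM.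
rewrite (congmxM _ _ _ YX); congr char_poly.
by apply: eq_congmx => i; rewrite expr2 mulrAC.
Qed.

Lemma singular_value_congmx_le n (X : 'M[C]_n) f g j :
  (forall i, 0 <= f i <= g i) ->
  singular_value (congmx X f) j <= singular_value (congmx X g) j.
Proof.
move=> fg; apply: singular_value_le.
- by apply: congmx_possemidef => i; case/andP: (fg i).
- by apply: congmx_possemidef => i; case/andP: (fg i) => /le_trans; apply.
rewrite /lemx congmxB; apply: congmx_possemidef => i.
by rewrite subr_ge0; case/andP: (fg i).
Qed.

Lemma possemidef_congmx_ge0 n (X : 'M[C]_n) f i : X \in unitmx ->
  possemidefmx (congmx X f) -> 0 <= f i.
Proof.
(* The test vector is chosen so that [X^t*] maps it to the basis vector number [i], which isolates
   [f i]. *)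
move=> Xu /(_ ((invmx X)^t* *m delta_mx i 0)).
rewrite qform_congmx mulmxA -adjmxM mulVmx // trmx1 map_mx1 mul1mx.
rewrite (bigD1 i) //= big1 => [|k ki]; last first.
  by rewrite !mxE (negPf ki) normr0 expr0n mulr0.
by rewrite !mxE !eqxx normr1 expr1n mulr1 addr0.
Qed.

(** * Scalar inequalities between the weights *)

Section ScalarMeans.
Variable s : C.
Hypotheses (s_gt0 : 0 < s) (s_le1 : s <= 1).
Let c := s ^+ 2.

Let sN0 : s != 0. Proof. exact: lt0r_neq0. Qed.
Let cD1N0 : 1 + s ^+ 2 != 0.
Proof. by rewrite gt_eqF // ltr_pwDl ?exprn_ge0 ?ltW. Qed.
Let B1s_ge0 : 0 <= 1 - s. Proof. by rewrite subr_ge0. Qed.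
Let B1c_ge0 : 0 <= 1 - c. Proof. by rewrite subr_ge0 exprn_ile1 // ltW. Qed.

Lemma mean_gap_ge0 : 0 <= 2^-1 * (1 + c) - s.
Proof.
have -> : 2^-1 * (1 + c) - s = (1 - s) ^+ 2 / 2 by rewrite /c; field.
by rewrite divr_ge0 ?exprn_ge0.
Qed.

(** As 1 - c = (1 - s)(1 + s), both sides contain (1 - s)^2, and (1 + s)^2 - 4s = (1 - s)^2 remains.
    This is where the constant 1/8 fits. *)
Lemma mean_gap_le_geometric : 2^-1 * (1 + c) - s <= 8^-1 * ((1 - c) ^+ 2 / s).
Proof.
rewrite -subr_ge0; have -> : 8^-1 * ((1 - c) ^+ 2 / s) - (2^-1 * (1 + c) - s)
    = (1 - s) ^+ 4 / (8 * s) by rewrite /c; field.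
by rewrite divr_ge0 ?exprn_ge0 // mulr_ge0 // ltW.
Qed.

(** The factor 1 - s of the difference carries the assumption B <= A: it says that c = s^2 is at
    most s. *)
Lemma geometric_le_min : (1 - c) ^+ 2 / s <= (1 - c) ^+ 2 / c.
Proof.
rewrite -subr_ge0; have -> : (1 - c) ^+ 2 / c - (1 - c) ^+ 2 / s
    = (1 - c) ^+ 2 * (1 - s) / s ^+ 2 by rewrite /c; field.
by rewrite divr_ge0 ?mulr_ge0 ?exprn_ge0 // ltW.
Qed.

(** After removal of (1 - s)^2 the same square appears: 2(1 + s^2) - (1 + s)^2 = (1 - s)^2. *)
Lemma arithmetic_le_mean_gap :
  8^-1 * ((1 - c) ^+ 2 / (2^-1 * (1 + c))) <= 2^-1 * (1 + c) - s.
Proof.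
rewrite -subr_ge0.
have -> : 2^-1 * (1 + c) - s - 8^-1 * ((1 - c) ^+ 2 / (2^-1 * (1 + c)))
    = (1 - s) ^+ 4 / (4 * (1 + s ^+ 2)) by rewrite /c; field.
by rewrite divr_ge0 ?exprn_ge0 // mulr_ge0 // addr_ge0 ?exprn_ge0 // ltW.
Qed.

(** The divisor 1 is the weight of A, kept so that the statement matches the general quotient by a
    weight. *)
Lemma max_le_arithmetic : (1 - c) ^+ 2 / 1 <= (1 - c) ^+ 2 / (2^-1 * (1 + c)).
Proof.
rewrite -subr_ge0.
have -> : (1 - c) ^+ 2 / (2^-1 * (1 + c)) - (1 - c) ^+ 2 / 1
    = (1 - c) ^+ 3 / (1 + s ^+ 2) by rewrite /c; field.
by rewrite divr_ge0 ?exprn_ge0 // addr_ge0 ?exprn_ge0 // ltW.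
Qed.

End ScalarMeans.

(** * Assembly of the two chains *)

Lemma mean_gap_singular_values n (A B : 'M[C]_n) j :
  posdefmx A -> posdefmx B -> lemx B A ->
  (singular_value (amean A B - gmean A B) j
     <= 8^-1 * singular_value
          (rsqrtmx (gmean A B) *m (A - B) ^+ 2 *m rsqrtmx (gmean A B)) j
     <= 8^-1 * singular_value (rsqrtmx B *m (A - B) ^+ 2 *m rsqrtmx B) j)
  /\
  (8^-1 * singular_value (rsqrtmx A *m (A - B) ^+ 2 *m rsqrtmx A) j
     <= 8^-1 * singular_value
          (rsqrtmx (amean A B) *m (A - B) ^+ 2 *m rsqrtmx (amean A B)) j
     <= singular_value (amean A B - gmean A B) j).
Proof.
move=> Ap Bp; have [X [s [Xu s0 eA eB ->]]] := posdef_pair_diag Ap Bp.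
have -> : amean A B = congmx X (fun i => 2^-1 * (1 + s i ^+ 2)).
  by rewrite /amean eA eB congmxD congmxZ.
(* A - B has weights 1 - s^2, so B <= A amounts to their nonnegativity, from which s <= 1
   follows. *)
rewrite /lemx eA eB !congmxB => /(possemidef_congmx_ge0 _ Xu) c1.
have s1 i : s i <= 1.
  by rewrite -(@expr_le1 _ 2 _ isT (ltW (s0 i))) -subr_ge0.
(* The factor 1/8 is absorbed into the weights, so that every term becomes a singular value of a
   congruence by the same [X]. *)
have rsqrtE m : (forall i, 0 < m i) -> 8^-1 * singular_value
      (rsqrtmx (congmx X m) *m congmx X (fun i => 1 - s i ^+ 2) ^+ 2
         *m rsqrtmx (congmx X m)) j
    = singular_value (congmx X (fun i => 8^-1 * ((1 - s i ^+ 2) ^+ 2 / m i))) j.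
  move=> m0; rewrite -congmxZ singular_valueZ ?invr_gt0 //; last first.
    apply: congmx_possemidef => i.
    by rewrite divr_ge0 ?exprn_ge0 // ltW.
  rewrite /singular_value singular_values_rsqrt_congmx // => i.
  exact: ger0_real.
have weight_ge0 m i : 0 < m -> 0 <= 8^-1 * ((1 - s i ^+ 2) ^+ 2 / m).
  by move=> m0; rewrite mulr_ge0 ?invr_ge0 // divr_ge0 ?exprn_ge0 // ltW.
have s2 i : 0 < s i ^+ 2 by rewrite exprn_gt0.
have a0 i : 0 < 2^-1 * (1 + s i ^+ 2) by rewrite mulr_gt0 ?invr_gt0 // addr_gt0.
have one_gt0 (i : 'I_n) : (0 : C) < 1 := ltr01.
rewrite (rsqrtE _ s0) (rsqrtE _ s2) (rsqrtE _ a0) (rsqrtE _ one_gt0).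
split; apply/andP; split; apply: singular_value_congmx_le => i.
- by apply/andP; split; [apply: mean_gap_ge0 | apply: mean_gap_le_geometric].
- by rewrite weight_ge0 // ler_pM2l ?invr_gt0 // geometric_le_min.
- by rewrite weight_ge0 // ler_pM2l ?invr_gt0 // max_le_arithmetic.
- by rewrite weight_ge0 // arithmetic_le_mean_gap.
Qed.

End Matrices.

Theorem corollary2p2 (R : realType) (n : nat) (A B : 'M[R[i]]_n)
    (hA : posdefmx A) (hB : posdefmx B) (hBA : lemx B A) (j : 'I_n) :
  (singular_value (amean A B - gmean A B) j
     <= 8^-1 * singular_value
          (rsqrtmx (gmean A B) *m (A - B) ^+ 2 *m rsqrtmx (gmean A B)) j
     <= 8^-1 * singular_value (rsqrtmx B *m (A - B) ^+ 2 *m rsqrtmx B) j)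
  /\
  (8^-1 * singular_value (rsqrtmx A *m (A - B) ^+ 2 *m rsqrtmx A) j
     <= 8^-1 * singular_value
          (rsqrtmx (amean A B) *m (A - B) ^+ 2 *m rsqrtmx (amean A B)) j
     <= singular_value (amean A B - gmean A B) j).
Proof. exact: mean_gap_singular_values. Qed.
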